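(* Let $\delta\in(0,1)$ and let $\pi$ be a policy. Assume that for each fixed state $\phi\in\mathcal S$ and weights $\mathbf w$ the map $\mathbf x\mapsto\mathrm{Upd}(\phi,\mathbf w,\mathbf x)$ is $L_h$-Lipschitz in $\mathbf x$ through the memory component $h$, i.e. $\mathbf x$ affects $\mathrm{Upd}(\phi,\mathbf w,\mathbf x)$ only through its memory component and $\|h(\mathrm{Upd}(\phi,\mathbf w,\mathbf x))-h(\mathrm{Upd}(\phi,\mathbf w,\mathbf y))\|\le L_h\|\mathbf x-\mathbf y\|_2$ for all $\mathbf x,\mathbf y\in\mathbb R^N$. Assume that $T_{\mathrm{scen}}^\pi$ and $T_{\mathrm{hyb}}^\pi$ are both $\delta$-contractions on $(\mathcal V,\|\cdot\|_\infty)$, and let $V_{\mathrm{scen}}^\pi$ and $V_{\mathrm{hyb}}^\pi$ in $\mathcal V$ be their respective fixed points. Assume $V_{\mathrm{scen}}^\pi$ is Lipschitz in the memory component $h$ (holding the exogenous context $z$ fixed), and let $L_V:=\mathrm{Lip}_h(V_{\mathrm{scen}}^\pi)$ be its Lipschitz constant in $h$. Then $$\|V_{\mathrm{hyb}}^\pi-V_{\mathrm{scen}}^\pi\|_\infty\le\frac{\delta}{1-\delta}\,L_VL_h\,\Delta_W,$$ where $$\Delta_W:=\sup_{o\in\mathcal O}W_1\Big(P_{\mathrm{real}}(\cdot\mid\Phi(o)),\,P_{\mathrm{scen}}(\cdot\mid\Psi(o))\Big)$$ and $W_1$ is the 1-Wasserstein distance with ground metric $d(\mathbf x,\mathbf y)=\|\mathbf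 x-\mathbf y\|_2$ on $\mathbb R^N$.
   Context: Setting. States are pairs $\phi=(z,h)\in\mathcal S$, where $z$ is exogenous context and $h=h(\phi)$ is a memory component lying in a normed space $(\mathcal H,\|\cdot\|)$. $\mathcal V$ is the space of bounded (measurable) functions $V:\mathcal S\to\mathbb R$ and $\|\cdot\|_\infty$ is the supremum norm over $\mathcal S$. $\mathrm{Lip}_h(V)$ is the smallest $L$ with $|V(z,h)-V(z,h')|\le L\|h-h'\|$ for all states $(z,h),(z,h')$. $\mathcal A$ is a measurable action space; a policy $\pi$ assigns to each $\phi\in\mathcal S$ a probability measure $\pi(\cdot\mid\phi)$ on $\mathcal A$. A (measurable) map $\Pi$ sends an action $a$ to executed portfolio weights $\mathbf w=\Pi(a)\in\mathbb R^N$. The deterministic (measurable) update map $\mathrm{Upd}:(\phi,\mathbf w,\mathbf x)\mapsto\mathrm{Upd}(\phi,\mathbf w,\mathbf x)\in\mathcal S$ takes a state, weights and a return vector $\mathbf x\in\mathbb R^N$ to the next state. Information. $o\in\mathcal O$ denotes the information available at a decision time; $\phi=\Phi(o)$ and $\psi=\Psi(o)$ are the state and a descriptor constructed from the same $o$, with $\mathcal S=\Phi(\mathcal O)$. In the operators below, the descriptor $\psi$ paired with a state $\phi$ is $\psi=\Psi(o)$ for some (fixed, arbitrary) $o$ with $\Phi(o)=\phi$. $P_{\mathrm{real}}(\cdot\mid\phi)$ and $P_{\mathrm{scen}}(\cdot\mid\psi)$ are probability laws on $\mathbb R^N$ (the real-world and the scenario law of the next return vector), not depending on the action. $r(\phi,\mathbf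 w;\mathbf x)\in\mathbb R$ is the one-step reward, assumed integrable so that the expectations below make sense. Operators. With $a\sim\pi(\cdot\mid\phi)$, $\mathbf w=\Pi(a)$ and, given $a$, $\mathbf R\sim P_{\mathrm{scen}}(\cdot\mid\psi)$ and $\mathbf r\sim P_{\mathrm{real}}(\cdot\mid\phi)$, $$(T_{\mathrm{hyb}}^\pi V)(\phi):=\mathbb E\big[r(\phi,\mathbf w;\mathbf R)+\delta V(\mathrm{Upd}(\phi,\mathbf w,\mathbf r))\,\big|\,\phi\big],$$ $$(T_{\mathrm{scen}}^\pi V)(\phi):=\mathbb E\big[r(\phi,\mathbf w;\mathbf R)+\delta V(\mathrm{Upd}(\phi,\mathbf w,\mathbf R))\,\big|\,\phi\big].$$ *)

(* Defs.v *)
From mathcomp Require Import all_boot all_order all_algebra.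
From mathcomp Require Import all_classical all_reals all_analysis.

Set Implicit Arguments.
Unset Strict Implicit.
Unset Printing Implicit Defensive.

Import Order.TTheory GRing.Theory Num.Theory.
Import numFieldNormedType.Exports.
Local Open Scope classical_set_scope.
Local Open Scope ring_scope.

(* R^N is [N.-tuple R]: its sigma-algebra, generated by the coordinates, is
   the Borel one. *)
Section Wasserstein.
Context {R : realType} {N : nat}.

Definition dist2 (x y : N.-tuple R) : R :=
  Num.sqrt (\sum_(i < N) (tnth x i - tnth y i) ^+ 2).

Definition has_law d d' (T : measurableType d) (U : measurableType d')
    (P : probability T R) (f : T -> U) (Q : set U -> \bar R) : Prop :=
  forall B, measurable B -> pushforward P f B = Q B.

Definition coupling (P Q : probability (N.-tuple R) R)
    (g : probability (N.-tuple R * N.-tuple R)%type R) : Prop :=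
  has_law g fst P /\ has_law g snd Q.

(* No moment assumption: the value may be +oo. *)
Definition W1 (P Q : probability (N.-tuple R) R) : \bar R :=
  ereal_inf [set (\int[g]_p (dist2 p.1 p.2)%:E)%E | g in coupling P Q].

Definition DeltaW (O S D : Type) (Phi : O -> S) (Psi : O -> D)
    (Preal : S -> probability (N.-tuple R) R)
    (Pscen : D -> probability (N.-tuple R) R) : \bar R :=
  ereal_sup [set W1 (Preal (Phi o)) (Pscen (Psi o)) | o in [set: O]].

End Wasserstein.

Section ValueFunctions.
Context {R : realType} {dS : measure_display} {S : measurableType dS}.

Definition bounded_measurable (V : S -> R) : Prop :=
  measurable_fun [set: S] V /\ bounded_fun V.

Definition supnorm (V : S -> R) : \bar R :=
  ereal_sup [set (`|V phi|)%:E | phi in [set: S]].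

Definition sup_contraction (delta : R) (T : (S -> R) -> (S -> R)) : Prop :=
  (forall V, bounded_measurable V -> bounded_measurable (T V)) /\
  (forall U V, bounded_measurable U -> bounded_measurable V ->
     supnorm (fun phi => T U phi - T V phi)%R
       <= delta%:E * supnorm (fun phi => U phi - V phi)%R)%E.

Definition is_fixed_point (T : (S -> R) -> (S -> R)) (V : S -> R) : Prop :=
  bounded_measurable V /\ T V = V.

End ValueFunctions.

(* A state phi is identified with the pair (z phi, h phi). *)
Section Memory.
Context {R : realType} {S Z : Type} {H : normedModType R}.
Variables (z : S -> Z) (h : S -> H).

(* Without [0 <= L] the set would be all of R when no two states share the
   same z and differ in h. *)
Definition lip_h_bounds (V : S -> R) : set R :=
  [set L | 0 <= L /\ forall phi phi', z phi = z phi' ->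
             `|V phi - V phi'| <= L * `|h phi - h phi'|].

Definition lipschitz_h (V : S -> R) : Prop := lip_h_bounds V !=set0.

Definition Lip_h (V : S -> R) : R := inf (lip_h_bounds V).

Definition lipschitz_through_h (N : nat)
    (Upd : S -> N.-tuple R -> N.-tuple R -> S) (Lh : R) : Prop :=
  0 <= Lh /\ forall phi w x y,
    z (Upd phi w x) = z (Upd phi w y) /\
    `|h (Upd phi w x) - h (Upd phi w y)| <= Lh * dist2 x y.

End Memory.

Section Operators.
Context {R : realType} {N : nat} {dS dA : measure_display}.
Context {S : measurableType dS} {A : measurableType dA}.
Local Notation RN := (N.-tuple R).

(* J is a joint law of (a, (R, r)). Only the laws of (a, R) and (a, r) are
   prescribed (R and r do not depend on a); the dependence between R and r
   given a is left free. *)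
Definition draw_law (pi : probability A R) (Pscen Preal : probability RN R)
    (J : probability (A * (RN * RN))%type R) : Prop :=
  has_law J (fun t => (t.1, t.2.1)) (pi \x Pscen)%E /\
  has_law J (fun t => (t.1, t.2.2)) (pi \x Preal)%E.

Variables (delta : R) (J : S -> probability (A * (RN * RN))%type R).
Variables (Pi : A -> RN) (r : S -> RN -> RN -> R) (Upd : S -> RN -> RN -> S).

Definition T_hyb (V : S -> R) (phi : S) : R :=
  fine 'E_(J phi)[fun t =>
    r phi (Pi t.1) t.2.1 + delta * V (Upd phi (Pi t.1) t.2.2)].

Definition T_scen (V : S -> R) (phi : S) : R :=
  fine 'E_(J phi)[fun t =>
    r phi (Pi t.1) t.2.1 + delta * V (Upd phi (Pi t.1) t.2.1)].

End Operators.

(* Main.v *)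
(* With F = Vhyb - Vscen, the fixed-point equations split F into
   T_hyb Vhyb - T_hyb Vscen, of sup norm at most delta ||F||, and the one-step
   error T_hyb Vscen - T_scen Vscen.  In the latter the rewards cancel, and for
   each action the map x |-> Vscen (Upd phi w x) is L_V L_h-Lipschitz, so the
   easy half of Kantorovich-Rubinstein duality bounds the error by
   delta L_V L_h Delta_W.  Hence (1 - delta) ||F|| <= delta L_V L_h Delta_W. *)

Require Import Defs.
From mathcomp Require Import all_boot all_order all_algebra.
From mathcomp Require Import all_classical all_reals all_analysis.
From mathcomp Require Import measurable_realfun.

Set Implicit Arguments.
Unset Strict Implicit.
Unset Printing Implicit Defensive.

Import Order.TTheory GRing.Theory Num.Theory.
Import numFieldNormedType.Exports.
Local Open Scope classical_set_scope.
Local Open Scope ring_scope.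

(** * Bounded measurable functions and change of variables *)

Lemma bounded_measurable_comp (R : realType) d d' (T : measurableType d)
    (U : measurableType d') (g : U -> R) (f : T -> U) :
  bounded_measurable g -> measurable_fun [set: T] f ->
  bounded_measurable (g \o f).
Proof.
move=> [mg [M [Mreal gM]]] mf; split; first exact: measurableT_comp.
by exists M; split=> // x /gM gx y _; exact: gx.
Qed.

Lemma bounded_measurable_integrable (R : realType) d (T : measurableType d)
    (P : probability T R) (f : T -> R) :
  bounded_measurable f -> P.-integrable [set: T] (EFin \o f).
Proof.
move=> [mf bf]; apply: measurable_bounded_integrable => //.
exact: le_lt_trans (probability_le1 P measurableT) (ltry 1).
Qed.

(** Change of variables along [f]; boundedness of [g] supplies the integrability that a signed
    integrand requires. *)
Lemma integral_has_law (R : realType) d d' (T : measurableType d)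
    (U : measurableType d') (P : probability T R) (f : T -> U)
    (Q : {measure set U -> \bar R}) (g : U -> R) :
  measurable_fun [set: T] f -> has_law P f Q -> bounded_measurable g ->
  (\int[P]_x (g (f x))%:E = \int[Q]_y (g y)%:E)%E.
Proof.
move=> mf PfQ bg.
have mg : measurable_fun [set: U] (EFin \o g).
  by apply/measurable_EFinP; case: bg.
rewrite -(@eq_measure_integral _ _ _ _ Q (pushforward P f)); last first.
  by move=> B mB _; exact: PfQ.
rewrite (integral_pushforward mf mg) //.
apply: (bounded_measurable_integrable P (f := g \o f)).
exact: bounded_measurable_comp.
Qed.

(** * Transport cost and couplings *)

Lemma measurable_dist2 (R : realType) (N : nat) :
  measurable_fun [set: N.-tuple R * N.-tuple R] (fun p => dist2 p.1 p.2).
Proof.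
apply: (measurableT_comp (f := @Num.sqrt R)).
  by apply: continuous_measurable_fun; exact: sqrt_continuous.
apply: measurable_sum => i; apply: measurable_funX.
by apply: measurable_funB; apply: (measurableT_comp (measurable_tnth i)).
Qed.

Lemma dist2_ge0 (R : realType) (N : nat) (x y : N.-tuple R) : 0 <= dist2 x y.
Proof. exact: sqrtr_ge0. Qed.

Lemma W1_ge0 (R : realType) (N : nat) (P Q : probability (N.-tuple R) R) :
  (0 <= W1 P Q)%E.
Proof.
apply/ereal_infP => _ [g _ <-].
by apply: integral_ge0 => p _; rewrite lee_fin dist2_ge0.
Qed.

(** Shows that couplings exist, which settles the degenerate Lipschitz constant 0 below. *)
Lemma coupling_product (R : realType) (N : nat)
    (P Q : probability (N.-tuple R) R) : coupling P Q (P \x Q)%E.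
Proof.
split=> B mB; rewrite /pushforward.
- rewrite (_ : fst @^-1` B = B `*` setT); last first.
    by rewrite predeqE => -[x y]; split=> [|[]].
  transitivity (P B * Q setT)%E; first exact: product_measure1E.
  by rewrite probability_setT mule1.
- rewrite (_ : snd @^-1` B = setT `*` B); last first.
    by rewrite predeqE => -[x y]; split=> [|[]].
  transitivity (P setT * Q B)%E; first exact: product_measure1E.
  by rewrite probability_setT mul1e.
Qed.

(** * Easy half of Kantorovich-Rubinstein duality *)

Section KantorovichRubinstein.
Context {R : realType} {N : nat} (P Q : probability (N.-tuple R) R) (K : R).
Hypothesis K0 : 0 <= K.

(** Both integrals are marginals of the same [c], so their difference is the [c]-integral of
    [g p.1 - g p.2], bounded pointwise. The final comparison is between nonnegative functions, so
    the cost may be infinite. *)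
Lemma integral_sub_le_coupling (g : N.-tuple R -> R) c :
  bounded_measurable g ->
  (forall x y, `|g x - g y| <= K * dist2 x y) ->
  coupling P Q c ->
  (`| \int[P]_x (g x)%:E - \int[Q]_x (g x)%:E |
    <= K%:E * \int[c]_p (dist2 p.1 p.2)%:E)%E.
Proof.
move=> bg gK [c1 c2].
have i1 := bounded_measurable_integrable c
  (bounded_measurable_comp bg measurable_fst).
have i2 := bounded_measurable_integrable c
  (bounded_measurable_comp bg measurable_snd).
rewrite -(integral_has_law measurable_fst c1 bg).
rewrite -(integral_has_law measurable_snd c2 bg).
rewrite -integralB_EFin//.
have mB : measurable_fun [set: N.-tuple R * N.-tuple R]
    (fun p => (g p.1)%:E - (g p.2)%:E)%E.
  apply: emeasurable_funB; first exact: measurable_int i1.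
  exact: measurable_int i2.
have md : measurable_fun [set: N.-tuple R * N.-tuple R]
    (fun p => (dist2 p.1 p.2)%:E).
  by apply/measurable_EFinP; exact: measurable_dist2.
apply: (le_trans (le_abse_integral _ _ mB)) => //.
rewrite -ge0_integralZl//; last first.
  by move=> p _; rewrite lee_fin dist2_ge0.
apply: ge0_le_integral => //.
- exact: measurableT_comp.
- exact: measurable_funeM.
- by move=> p _ /=; rewrite lee_fin; exact: gK.
Qed.

Lemma integral_sub_le_W1 (g : N.-tuple R -> R) :
  bounded_measurable g ->
  (forall x y, `|g x - g y| <= K * dist2 x y) ->
  (`| \int[P]_x (g x)%:E - \int[Q]_x (g x)%:E | <= K%:E * W1 P Q)%E.
Proof.
(* A factor moves inside the infimum only if it is positive. For [K = 0] the convention 0 * +oo = 0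
   makes the bound 0, and any one coupling yields it. *)
move=> bg gK; have [K_eq0|K_neq0] := eqVneq K 0.
  have := integral_sub_le_coupling bg gK (coupling_product P Q).
  by rewrite K_eq0 !mul0e.
have K_gt0 : 0 < K by rewrite lt_neqAle eq_sym K_neq0.
rewrite -ereal_inf_pZl//; apply/ereal_infP => _ [_ [c cPQ <-] <-].
exact: integral_sub_le_coupling.
Qed.

(** By Fubini the bound applies to each slice [g (a, _)]; it does not depend on [a], so averaging
    over the probability [mu] preserves it. *)
Lemma integral_prod_sub_le_W1 d (A : measurableType d) (mu : probability A R)
    (g : A * N.-tuple R -> R) :
  bounded_measurable g ->
  (forall a x y, `|g (a, x) - g (a, y)| <= K * dist2 x y) ->
  (`| \int[mu \x P]_p (g p)%:E - \int[mu \x Q]_p (g p)%:E |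
    <= K%:E * W1 P Q)%E.
Proof.
move=> bg gK.
have iP := bounded_measurable_integrable (mu \x P)%E bg.
have iQ := bounded_measurable_integrable (mu \x Q)%E bg.
rewrite -(integral12_prod_meas1 iP) -(integral12_prod_meas1 iQ).
have fP := integrable_fubini_F iP.
have fQ := integrable_fubini_F iQ.
rewrite -integralB//.
have mB := measurable_int _ (integrableB measurableT fP fQ).
have KW0 : (0 <= K%:E * W1 P Q)%E by rewrite mule_ge0// W1_ge0.
apply: (le_trans (le_abse_integral _ _ mB)) => //.
apply: (@le_trans _ _ (\int[mu]_a cst (K%:E * W1 P Q) a)%E).
  apply: ge0_le_integral => //; first exact: measurableT_comp.
  move=> a _; apply: integral_sub_le_W1 => //.
  exact: (bounded_measurable_comp bg (pair1_measurable a)).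
by rewrite integral_cst// -[leRHS]mule1 -(probability_setT mu).
Qed.

End KantorovichRubinstein.

(** * The Lipschitz constant in the memory component *)

Section LipschitzConstant.
Context {R : realType} {S Z : Type} {H : normedModType R}.
Variables (z : S -> Z) (h : S -> H) (V : S -> R).
Hypothesis Vlip : lipschitz_h z h V.

Lemma Lip_h_ge0 : 0 <= Lip_h z h V.
Proof. by apply: lb_le_inf => // L []. Qed.

(** The infimum is itself admissible: for distinct memories the difference quotient is a lower bound
    of all admissible constants; for equal memories any admissible constant forces equal values. *)
Lemma Lip_h_bound phi phi' : z phi = z phi' ->
  `|V phi - V phi'| <= Lip_h z h V * `|h phi - h phi'|.
Proof.
move=> zE; have [h0|h_neq0] := eqVneq `|h phi - h phi'| 0.
  by have [L [_ /(_ _ _ zE)]] := Vlip; rewrite h0 !mulr0.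
have h_gt0 : 0 < `|h phi - h phi'| by rewrite lt_neqAle eq_sym h_neq0 normr_ge0.
rewrite -ler_pdivrMr//; apply: lb_le_inf => // L [_ VL].
by rewrite ler_pdivrMr//; exact: VL.
Qed.

End LipschitzConstant.

(** * One-step error between the two operators *)

Section OneStep.
Context {R : realType} {N : nat} {dS dA : measure_display}.
Context {S : measurableType dS} {A : measurableType dA}.
Local Notation RN := (N.-tuple R).
Variables (Z : Type) (H : normedModType R) (z : S -> Z) (h : S -> H).
Variables (delta Lh : R) (J : S -> probability (A * (RN * RN))%type R).
Variables (Pi : A -> RN) (r : S -> RN -> RN -> R) (Upd : S -> RN -> RN -> S).
Variables (phi : S) (mu : probability A R) (P Q : probability RN R).
Hypothesis delta0 : 0 <= delta.
Hypothesis mPi : measurable_fun [set: A] Pi.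
Hypothesis mUpd : measurable_fun [set: S * (RN * RN)]
  (fun p => Upd p.1 p.2.1 p.2.2).
Hypothesis Upd_lip : lipschitz_through_h z h Upd Lh.
Hypothesis J_law : draw_law mu Q P (J phi).
Hypothesis r_int : (J phi).-integrable [set: A * (RN * RN)]
  (fun t => (r phi (Pi t.1) t.2.1)%:E).

Lemma T_hyb_sub_T_scen_le (V : S -> R) :
  bounded_measurable V -> lipschitz_h z h V ->
  ((`|T_hyb delta J Pi r Upd V phi - T_scen delta J Pi r Upd V phi|)%:E
    <= delta%:E * ((Lip_h z h V * Lh)%:E * W1 P Q))%E.
Proof.
move=> bV Vlip.
have [Lh0 Uzh] := Upd_lip; have [JQ JP] := J_law.
pose g (p : A * RN) := V (Upd phi (Pi p.1) p.2).
have bg : bounded_measurable g.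
  apply: (bounded_measurable_comp bV).
  apply: (measurableT_comp mUpd (g := fun p : A * RN => (phi, (Pi p.1, p.2)))).
  apply: measurable_fun_pair => //; apply: measurable_fun_pair => //.
  exact: measurableT_comp.
have m1 : measurable_fun [set: A * (RN * RN)] (fun t => (t.1, t.2.1)).
  apply: measurable_fun_pair => //.
  exact: (measurableT_comp measurable_fst measurable_snd).
have m2 : measurable_fun [set: A * (RN * RN)] (fun t => (t.1, t.2.2)).
  apply: measurable_fun_pair => //.
  exact: (measurableT_comp measurable_snd measurable_snd).
(* Here [f] selects the draw fed to the update. Only the law of [f] enters the continuation term, so
   the dependence between the two draws in [J phi] is irrelevant. *)
have T_E (f : A * (RN * RN) -> A * RN) nu : measurable_fun setT f ->
    has_law (J phi) f (nu : probability (A * RN)%type R) ->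
    fine 'E_(J phi)[fun t => r phi (Pi t.1) t.2.1 + delta * g (f t)] =
    \int[J phi]_t (r phi (Pi t.1) t.2.1) + delta * \int[nu]_p g p.
  move=> mf Jf; have ig := bounded_measurable_integrable (J phi)
    (bounded_measurable_comp bg mf).
  have idg := integrableZl measurableT delta ig.
  rewrite unlock -/(Rintegral _ _ _) RintegralD// RintegralZl//.
  by rewrite /Rintegral (integral_has_law mf Jf bg).
rewrite /T_hyb /T_scen (T_E _ _ m2 JP) (T_E _ _ m1 JQ).
rewrite opprD addrACA subrr add0r -mulrBr normrM ger0_norm// EFinM.
rewrite lee_wpmul2l ?lee_fin//.
have gK a x y :
    `|g (a, x) - g (a, y)| <= Lip_h z h V * Lh * dist2 x y.
  have [zE hL] := Uzh phi (Pi a) x y.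
  apply: (le_trans (Lip_h_bound Vlip zE)).
  by rewrite -mulrA ler_wpM2l// Lip_h_ge0.
have K0 : 0 <= Lip_h z h V * Lh by rewrite mulr_ge0// Lip_h_ge0.
have W1_bound := integral_prod_sub_le_W1 P Q K0 mu bg gK.
(* Finiteness ensures that [fine] loses nothing when passing back to extended reals. *)
have fin (m : probability (A * RN)%type R) :
    (\int[m]_p (g p)%:E)%E \is a fin_num.
  by apply: integrable_fin_num => //;
    exact: bounded_measurable_integrable.
by rewrite /Rintegral -abse_EFin EFinB !fineK; [exact: W1_bound|exact: fin..].
Qed.

End OneStep.

(** * Supremum norm and comparison of the fixed points *)

Section Supnorm.
Context {R : realType} {dS : measure_display} {S : measurableType dS}.

Lemma le_supnorm (f : S -> R) phi : ((`|f phi|)%:E <= supnorm f)%E.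
Proof. by apply: ereal_sup_ubound; exists phi. Qed.

Lemma supnorm_le (f : S -> R) x :
  (forall phi, (`|f phi|)%:E <= x)%E -> (supnorm f <= x)%E.
Proof. by move=> fx; apply/ereal_supP => _ [phi _ <-]. Qed.

(** The point [phi] is there because the supremum over an empty state space is -oo. *)
Lemma supnorm_fin (f : S -> R) (phi : S) :
  bounded_fun f -> supnorm f \is a fin_num.
Proof.
move=> [M [_ fM]]; rewrite fin_real//; apply/andP; split.
  exact: lt_le_trans (ltNyr _) (le_supnorm f phi).
(* [bounded_fun] gives a bound only by reals strictly above [M], hence [M + 1]. *)
apply: le_lt_trans (ltry (M + 1)); apply: supnorm_le => x.
by rewrite lee_fin; apply: fM => //; rewrite ltrDl.
Qed.

End Supnorm.
Theorem corollary3p3 (R : realType) (N : nat)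
  (* states phi = (z, h), with h in the normed space H *)
  (dS : measure_display) (S : measurableType dS)
  (Z : Type) (H : normedModType R) (z : S -> Z) (h : S -> H)
  (state_pairs : injective (fun phi => (z phi, h phi)))
  (* information, states, descriptors; [info phi] is the fixed o with
     Phi o = phi used in the operators, so that S = Phi(O) *)
  (O D : Type) (Phi : O -> S) (Psi : O -> D)
  (info : S -> O) (Phi_info : forall phi, Phi (info phi) = phi)
  (Preal : S -> probability (N.-tuple R) R)
  (Pscen : D -> probability (N.-tuple R) R)
  (dA : measure_display) (A : measurableType dA)
  (pi : S -> probability A R)
  (Pi : A -> N.-tuple R) (mPi : measurable_fun [set: A] Pi)
  (Upd : S -> N.-tuple R -> N.-tuple R -> S)
  (mUpd : measurable_fun [set: S * (N.-tuple R * N.-tuple R)]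
            (fun p => Upd p.1 p.2.1 p.2.2))
  (r : S -> N.-tuple R -> N.-tuple R -> R)
  (* joint law of the action, the scenario draw and the real draw *)
  (J : S -> probability (A * (N.-tuple R * N.-tuple R))%type R)
  (J_law : forall phi,
     draw_law (pi phi) (Pscen (Psi (info phi))) (Preal phi) (J phi))
  (r_int : forall phi,
     (J phi).-integrable [set: A * (N.-tuple R * N.-tuple R)]
       (fun t => (r phi (Pi t.1) t.2.1)%:E))
  (delta : R) (delta01 : 0 < delta < 1)
  (Lh : R) (Upd_lip : lipschitz_through_h z h Upd Lh)
  (scen_contr : sup_contraction delta (T_scen delta J Pi r Upd))
  (hyb_contr : sup_contraction delta (T_hyb delta J Pi r Upd))
  (Vscen Vhyb : S -> R)
  (Vscen_fix : is_fixed_point (T_scen delta J Pi r Upd) Vscen)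
  (Vhyb_fix : is_fixed_point (T_hyb delta J Pi r Upd) Vhyb)
  (Vscen_lip : lipschitz_h z h Vscen) :
  (supnorm (fun phi => Vhyb phi - Vscen phi)%R
     <= (delta / (1 - delta) * Lip_h z h Vscen * Lh)%:E
        * DeltaW Phi Psi Preal Pscen)%E.
Proof.
have [delta0 delta1] := andP delta01.
have [Lh0 _] := Upd_lip.
have L0 := Lip_h_ge0 Vscen_lip.
have [bscen scenE] := Vscen_fix; have [bhyb hybE] := Vhyb_fix.
set W := DeltaW _ _ _ _; set K := Lip_h z h Vscen * Lh.
set F := fun phi => Vhyb phi - Vscen phi.
have K0 : 0 <= K by exact: mulr_ge0.
(* Grouping [K] with [W] keeps their product a single extended real, which is 0 when [K = 0] even if
   [W] is infinite. *)
have WKE : ((delta / (1 - delta) * Lip_h z h Vscen * Lh)%:E * W =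
    (delta / (1 - delta))%:E * (K%:E * W))%E.
  by rewrite muleA -EFinM mulrA.
rewrite WKE; apply: supnorm_le => phi.
have bF : bounded_fun F.
  exact: (bounded_funD (proj2 bhyb) (bounded_funN (proj2 bscen))).
have W1W phi' : (W1 (Preal phi') (Pscen (Psi (info phi'))) <= W)%E.
  by apply: ereal_sup_ubound; exists (info phi') => //; rewrite Phi_info.
have KW0 : (0 <= K%:E * W)%E.
  by rewrite mule_ge0// (le_trans (W1_ge0 _ _) (W1W phi)).
apply: (le_trans (le_supnorm F phi)).
have step : (supnorm F <= delta%:E * supnorm F + delta%:E * (K%:E * W))%E.
  apply: supnorm_le => phi'.
  have -> : F phi' =
      (T_hyb delta J Pi r Upd Vhyb phi' - T_hyb delta J Pi r Upd Vscen phi') +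
      (T_hyb delta J Pi r Upd Vscen phi' - T_scen delta J Pi r Upd Vscen phi').
    by rewrite hybE scenE addrA subrK.
  apply: (@le_trans _ _ (_%:E + _%:E)%E).
    by rewrite -EFinD lee_fin; exact: ler_normD.
  apply: leeD.
    apply: le_trans (proj2 hyb_contr _ _ bhyb bscen).
    by apply: ereal_sup_ubound; exists phi'.
  apply: le_trans (T_hyb_sub_T_scen_le (ltW delta0) mPi mUpd Upd_lip
    (J_law phi') (r_int phi') bscen Vscen_lip) _.
  rewrite lee_wpmul2l ?lee_fin ?(ltW delta0)//.
  by rewrite lee_wpmul2l ?lee_fin//; exact: W1W.
have dd0 : 0 < delta / (1 - delta) by rewrite divr_gt0// subr_gt0.
(* Since [supnorm F] is finite, its multiple by [delta] can be subtracted when [K * W] is finite. If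
   [K * W] is +oo the positive factor makes the bound +oo; -oo contradicts [KW0]. *)
move: step KW0; rewrite -(fineK (supnorm_fin phi bF)).
case: (K%:E * W)%E => [m| |//].
- rewrite -!EFinM -EFinD !lee_fin => step _.
  rewrite mulrAC ler_pdivlMr ?subr_gt0// mulrBr mulr1 lerBlDr addrC.
  by rewrite [_ * delta]mulrC.
- by move=> _ _; rewrite gt0_muley ?lte_fin// leey.
Qed.
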